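(* Let $X$ be a compact space and let $\kappa$ be a cardinal such that $\chi(x,X)\leq\kappa$ for all $x\in X$. Then $X\times 2^\kappa$ is pin homogeneous.
   Context: All spaces are assumed to be Hausdorff. The character $\chi(x,X)$ of a point $x$ in a space $X$ is the least cardinality of a neighborhood base at $x$ in $X$. The space $2^\kappa$ is the product of $\kappa$ copies of the two-point discrete space. Points $a,b$ in a compact space $X$ are pin equivalent (in $X$) if there exist a compact space $Y$, a continuous surjection $f\colon Y\to X$, and a homeomorphism $g\colon Y\to Y$ such that $g(f^{-1}\{a\})=f^{-1}\{b\}$. A compact space is pin homogeneous if every two of its points are pin equivalent. *)

(* Defs.v *)
From HB Require Import structures.
From mathcomp Require Import all_boot.
From mathcomp Require Import all_classical.
From mathcomp Require Import topology.

Set Implicit Arguments.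
Unset Strict Implicit.
Unset Printing Implicit Defensive.

Local Open Scope classical_set_scope.
Local Open Scope card_scope.

Definition compact_hausdorff (T : topologicalType) : Prop :=
  compact [set: T] /\ hausdorff_space T.

(* Members of a neighborhood base need not be open. *)
Definition nbhs_base (T : topologicalType) (x : T) (B : set (set T)) : Prop :=
  B `<=` nbhs x /\ nbhs x `<=` filter_from B id.

Definition least_nbhs_base (T : topologicalType) (x : T)
    (B : set (set T)) : Prop :=
  nbhs_base x B /\ forall C, nbhs_base x C -> B #<= C.

(* Cardinals are represented by sets compared with #<=, so the character of x
   is represented by a neighborhood base at x of least cardinality. The default
   value is never used, by characterP below. *)
Definition character (T : topologicalType) (x : T) : set (set T) :=
  xget (nbhs x : set (set T)) [set B | least_nbhs_base x B].

Definition homeomorphism (S T : topologicalType) (g : S -> T) : Prop :=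
  exists h : T -> S,
    [/\ cancel g h, cancel h g, continuous g & continuous h].

Definition pin_equivalent (X : topologicalType) (a b : X) : Prop :=
  exists (Y : topologicalType) (f : Y -> X) (g : Y -> Y),
    [/\ compact_hausdorff Y,
        continuous f,
        range f = [set: X],
        homeomorphism g &
        g @` (f @^-1` [set a]) = f @^-1` [set b]].

Definition pin_homogeneous (X : topologicalType) : Prop :=
  compact_hausdorff X /\ forall a b : X, pin_equivalent a b.

Lemma card_le_min (T : Type) (F : set (set T)) : F !=set0 ->
  exists2 A, F A & forall B, F B -> A #<= B.
Proof.
case=> B0 FB0.
pose P (S : set (set T -> T)) :=
  (forall s B, S s -> F B -> B (s B)) /\
  (forall s s' B, S s -> S s' -> F B -> s B = s' B -> s = s').
have [G GP Gtot|S [[SF Sinj] Smax]] := @Zorn_bigcup _ P.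
  split=> [s B [S GS Ss] FB|s s' B [S GS Ss] [S' GS' Ss'] FB].
    exact: (GP _ GS).1 Ss FB.
  have [SS'|S'S] := Gtot _ _ GS GS'.
    exact: (GP _ GS').2 (SS' _ Ss) Ss' FB.
  exact: (GP _ GS).2 Ss (S'S _ Ss') FB.
have [[B FB SB]|ncov] :=
    pselect (exists2 B, F B & forall b, B b -> exists2 s, S s & s B = b).
  exists B => // C FC; apply: (@card_le_trans _ _ _ S).
    apply: (card_le_trans _ (card_image_le (fun s => s B) S)).
    by apply: subset_card_le => b /SB[s Ss <-]; exists s.
  have injC : {in S &, injective (fun s : set T -> T => s C)}.
    by move=> s s' /set_mem Ss /set_mem Ss'; exact: Sinj Ss Ss' FC.
  have /card_eqPle[_ le_im] := inj_card_eq injC.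
  apply: (card_le_trans le_im).
  by apply: subset_card_le => _ [s Ss <-]; exact: SF Ss FC.
have exb B : F B -> exists b, B b /\ forall s, S s -> s B <> b.
  move=> FB; apply: contrapT => nex; apply: ncov; exists B => // b Bb.
  apply: contrapT => ns; apply: nex; exists b; split=> // s Ss sb.
  by apply: ns; exists s.
have [b0 _] := exb _ FB0.
have /choice[t tP] : forall B, exists b : T,
    F B -> B b /\ forall s, S s -> s B <> b.
  move=> B; have [/exb[b]|nFB] := pselect (F B); first by exists b.
  by exists b0.
exfalso; apply: (Smax (t |` S)).
  split=> [s Ss|tSS]; first by right.
  by apply: ((tP _ FB0).2 t) => //; apply: tSS; left.
split=> [s B [->|Ss] FB|s s' B [->|Ss] [->|Ss'] FB] //.
- exact: (tP _ FB).1.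
- exact: SF Ss FB.
- by move=> /esym; have := (tP _ FB).2 _ Ss'.
- by have := (tP _ FB).2 _ Ss.
- exact: Sinj Ss Ss' FB.
Qed.

Lemma nbhs_base_nbhs (T : topologicalType) (x : T) : nbhs_base x (nbhs x).
Proof. by split=> // U xU; exists U. Qed.

Lemma characterP (T : topologicalType) (x : T) :
  least_nbhs_base x (character x).
Proof.
apply: xgetPex.
have [|B xB Bmin] := @card_le_min _ [set B | nbhs_base x B].
  by exists (nbhs x); exact: nbhs_base_nbhs.
by exists B.
Qed.

(* Main.v *)
(* Points a, b of a compact space Z are pin equivalent as soon as there is a
   closed relation R on Z, total on both sides, relating a only to b and only a
   to b: take Y to be the space of bi-infinite R-chains in Z^int, f the
   coordinate at 0 and g the shift. For Z = X * 2^K, each point a = (x, s) has K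
   pairs of closed sets covering Z, namely "close to x at stage k and agreeing
   with s at k" and its approximate negation, and R relates z to w when, for
   every k, z and w can be put on the same side of their k-th pairs. Totality
   holds because, keeping the X-coordinate equal to x, the bits of the cube
   factor realize any prescribed sequence of sides. *)

Require Import Defs.
From mathcomp Require Import all_boot.
From mathcomp Require Import ssralg ssrint.
From mathcomp Require Import all_classical.
From mathcomp Require Import topology.

Set Implicit Arguments.
Unset Strict Implicit.
Unset Printing Implicit Defensive.

Local Open Scope classical_set_scope.
Local Open Scope card_scope.

(** * Products and closed subspaces of compact Hausdorff spaces *)

Section product.
Import ArrowAsProduct.

Lemma continuous_coord (I : Type) (T : I -> topologicalType) (i : I) :
  continuous (fun f : prod_topology T => f i).
Proof. exact: (@proj_continuous {classic I}). Qed.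

Lemma continuous_prod_topology (S : topologicalType) (I : Type)
    (T : I -> topologicalType) (f : S -> prod_topology T) :
  (forall i, continuous (fun s => f s i)) -> continuous f.
Proof.
(* The product topology is the supremum of the topologies pulled back along the coordinates, so each
   coordinate is treated alone. *)
move=> fc s; apply/cvg_sup => i U [_ [[V oV <-] Vs VU]].
apply: (@filterS _ (f @ s) _ _ _ VU).
by apply: (fc i s); exact: open_nbhs_nbhs.
Qed.

Lemma compact_hausdorff_prod_topology (I : Type) (T : I -> topologicalType) :
  (forall i, compact_hausdorff (T i)) -> compact_hausdorff (prod_topology T).
Proof.
move=> cT; split.
  have := @tychonoff {classic I} T (fun i => [set: T i]) (fun i => (cT i).1).
  by congr (compact _); apply/seteqP; split.
by apply: (@hausdorff_product {classic I}) => i; exact: (cT i).2.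
Qed.

End product.

Lemma compact_hausdorff_setX (S T : topologicalType) :
  compact_hausdorff S -> compact_hausdorff T -> compact_hausdorff (S * T)%type.
Proof.
move=> [cS hS] [cT hT]; split; first by rewrite -setXTT; exact: compact_setX.
move=> [p1 p2] [q1 q2] pq; congr pair; [apply: hS|apply: hT] => A B pA qB.
  have [||[z1 z2] [/= Az Bz]] := pq (fst @^-1` A) (fst @^-1` B).
  - exact: (@cvg_fst _ _ (nbhs p1) (nbhs p2)).
  - exact: (@cvg_fst _ _ (nbhs q1) (nbhs q2)).
  - by exists z1.
have [||[z1 z2] [/= Az Bz]] := pq (snd @^-1` A) (snd @^-1` B).
- exact: (@cvg_snd _ _ (nbhs p1) (nbhs p2)).
- exact: (@cvg_snd _ _ (nbhs q1) (nbhs q2)).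
- by exists z2.
Qed.

Section subtype.
Variables (T : topologicalType) (A : set T).

Lemma continuous_set_val : continuous (set_val : A -> T).
Proof. exact: initial_continuous. Qed.

Lemma continuous_to_subtype (S : topologicalType) (f : S -> A) :
  continuous (set_val \o f) -> continuous f.
Proof.
move=> fc s U [_ [[V oV <-] Vs VU]].
apply: (@filterS _ (f @ s) _ _ _ VU).
by apply: (fc s); exact: open_nbhs_nbhs.
Qed.

Lemma compact_hausdorff_subtype :
  compact_hausdorff T -> closed A -> compact_hausdorff A.
Proof.
move=> [cT hT] clA; split=> [F FF _|p q pq].
  (* The image of [F] under [set_val] clusters at a point of [A], and [F] clusters at the same point
     of the subtype. *)
  have cA : compact A := subclosed_compact clA cT (@subsetT _ A).
  have [|p [Ap Fp]] := cA (set_val @ F) _.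
    by apply: (@filterE _ F) => z; exact: set_valP.
  exists (exist _ p (mem_set Ap)); split=> // P Q FP [_ [[V oV <-] Vp VQ]].
  have [||_ [[z Pz <-] Vz]] := Fp (set_val @` P) V.
  - by apply: (@filterS _ F _ _ _ _ FP) => z Pz; exists z.
  - exact: open_nbhs_nbhs.
  - by exists z; split=> //; exact: VQ.
apply: val_inj; apply: hT => B C pB qC.
have [||z [Bz Cz]] := pq (set_val @^-1` B) (set_val @^-1` C).
- exact: continuous_set_val.
- exact: continuous_set_val.
- by exists (set_val z).
Qed.

End subtype.

Lemma closed_relation_pin_equivalent (Z : topologicalType) (a b : Z)
    (R : Z -> Z -> Prop) :
  compact_hausdorff Z ->
  closed [set zw : Z * Z | R zw.1 zw.2] ->
  (forall z, exists w, R z w) -> (forall w, exists z, R z w) ->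
  (forall z w, R z w -> z = a <-> w = b) ->
  pin_equivalent a b.
Proof.
move=> chZ clR /choice[s Rs] /choice[p Rp] Rab.
pose C : set {ptws int -> Z} := [set y | forall n, R (y n) (y (n + 1)%R)].
have clC : closed C.
  rewrite (_ : C = \bigcap_n
      (fun y : {ptws int -> Z} => (y n, y (n + 1)%R)) @^-1`
      [set zw : Z * Z | R zw.1 zw.2]); last first.
    by apply/seteqP; split=> [y Cy n _|y Cy n]; [exact: Cy|exact: (Cy n)].
  apply: closed_bigI => n _; apply: preimage_closed clR => y _.
  apply: (@cvg_pair _ _ _ (nbhs y) (nbhs (y n)) (nbhs (y (n + 1)%R)));
    exact: (@continuous_coord _ (fun=> Z)).
have shiftC (e : int) (y : C) : (fun n => set_val y (n + e)%R) \in C.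
  apply: mem_set => n /=; rewrite GRing.addrAC.
  exact: (set_valP y).
pose shift e (y : C) : C := exist (fun z => z \in C) _ (shiftC e y).
have shiftK e e' : (e + e')%R = 0%R -> cancel (shift e) (shift e').
  move=> ee' y; apply/val_inj/funext => n /=.
  by rewrite set_valE /= -GRing.addrA (GRing.addrC e') ee' GRing.addr0.
have shift_cont e : continuous (shift e).
  apply: continuous_to_subtype; apply: continuous_prod_topology => n y.
  apply: (@continuous_comp _ _ _ set_val
    (fun f : {ptws int -> Z} => f (n + e)%R)).
    exact: continuous_set_val.
  exact: continuous_coord.
exists C, (fun y : C => set_val y 0%R), (shift 1%R); split.
- apply: compact_hausdorff_subtype => //.
  exact: compact_hausdorff_prod_topology.
- move=> y; apply: (@continuous_comp _ _ _ set_val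
    (fun f : {ptws int -> Z} => f 0%R)).
    exact: continuous_set_val.
  exact: continuous_coord.
- apply/seteqP; split=> // z _.
  (* A chain with [z] at 0: successors to the right, predecessors to the left. [Negz m] is -(m+1),
     hence [m.+1] applications of [p]. *)
  pose y (n : int) := match n with
    | Posz m => iter m s z | Negz m => iter m.+1 p z end.
  have Cy : y \in C.
    apply: mem_set => -[m|[|m]] /=; last 2 first.
    + exact: Rp.
    + by rewrite subn1; exact: Rp.
    by rewrite addn1; exact: Rs.
  by exists (exist _ y Cy).
- exists (shift (-1)%R); split=> //; apply: shiftK.
    by rewrite GRing.addrN.
  by rewrite GRing.addNr.
have Ry (y : C) : R (set_val y 0%R) (set_val (shift 1%R y) 0%R).
  by case: y => y yC; have /set_mem/(_ 0%R) := yC.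
apply/seteqP; split=> [_ [y ya <-]|y yb]; first exact/(Rab _ _ (Ry y)).
(* The preimage of [y] is its backward shift, whose coordinate at 0 is related to [b] and so equals
   [a]. *)
have E : shift 1%R (shift (-1)%R y) = y by apply: shiftK; rewrite GRing.addNr.
by exists (shift (-1)%R y) => //; apply/(Rab _ _ (Ry _)); rewrite E.
Qed.

(** A base at [x] of least cardinality injects into [K]. A point in the closure of every base member
    cannot be separated from [x]. *)
Lemma character_closed_pseudobase (X : topologicalType) (K : Type) (x : X) :
  hausdorff_space X -> character x #<= [set: K] ->
  exists U : K -> set X, (forall k, nbhs x (U k)) /\
    forall z, (forall k, closure (U k) z) -> z = x.
Proof.
move=> hX /card_leP[i].
have [[Bx xB] _] := characterP x.
(* [U k] is the base member with index [k], and the whole space if [k] indexes none. *)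
have /choice[U UP] : forall k, exists U : set X, nbhs x U /\
    forall B : character x, set_val (i B) = k -> U = set_val B.
  move=> k; have [[B Bk]|nB] := pselect (exists B, set_val (i B) = k).
    exists (set_val B); split=> [|B' B'k]; first by apply: Bx; exact: set_valP.
    congr set_val; apply: (@inj _ _ _ i); rewrite ?inE //.
    by apply: val_inj; rewrite -set_valE Bk B'k.
  by exists setT; split=> [|B Bk]; [exact: filterT|case: nB; exists B].
exists U; split=> [k|z Uz]; first exact: (UP k).1.
apply/esym/hX => V W xV zW; have [B cB BV] := xB V xV.
pose B' : character x := exist _ B (mem_set cB).
have [w [Uw Ww]] := Uz (set_val (i B')) W zW.
by exists w; split=> //; apply: BV; rewrite ((UP _).2 B' erefl) in Uw.
Qed.

Lemma closed_code (X : topologicalType) (K : Type)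
    (a : X * {ptws K -> bool}) :
  hausdorff_space X -> character a.1 #<= [set: K] ->
  exists S : K -> bool -> set (X * {ptws K -> bool}),
    [/\ forall k c, closed (S k c),
        forall z k, exists c, S k c z,
        forall c : K -> bool, exists z, forall k, S k (c k) z,
        forall k, ~ S k false a &
        forall z, (forall k, S k true z) -> z = a].
Proof.
case: a => x s /= hX /(character_closed_pseudobase hX)[U [xU Ux]].
pose Z := (X * {ptws K -> bool})%type.
have fst_cont : continuous (fst : Z -> X) by move=> z; exact: cvg_fst.
have closed_bit k c : closed [set z : Z | z.2 k = c].
  apply: (@preimage_closed Z bool (fun z => z.2 k) [set c]) => [z _|].
    apply: (@continuous_comp _ _ _ snd (fun f : {ptws K -> bool} => f k)).
      exact: cvg_snd.
    exact: continuous_coord.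
  exact: discrete_closed.
(* Closure on one side and complement of the interior on the other keep both sets closed and still
   covering; they may overlap. *)
exists (fun k c => if c
  then fst @^-1` closure (U k) `&` [set z | z.2 k = s k]
  else fst @^-1` (~` interior (U k)) `|` [set z | z.2 k = ~~ s k]); split.
- move=> k [] /=.
    apply: closedI => //.
    by apply: preimage_closed => //; exact: closed_closure.
  apply: closedU => //.
  by apply: preimage_closed => //; apply: open_closedC; exact: open_interior.
- move=> [u t] k; have [Uu|nUu] := pselect (interior (U k) u); last first.
    by exists false; left.
  have [ts|ts] := eqVneq (t k) (s k); last first.
    by exists false; right => /=; case: (t k) (s k) ts => [] [].
  by exists true; split=> //; apply: subset_closure; exact: interior_subset.
(* Since [x] lies in every [closure (U k)], the bit at [k] alone can select the side. *)
- move=> c; exists (x, fun k => if c k then s k else ~~ s k) => k.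
  case ck: (c k); last by right; rewrite /= ck.
  by split; [apply: subset_closure; exact: nbhs_singleton|rewrite /= ck].
- by move=> k [/(_ (xU k))//|/=]; case: (s k).
- move=> [u t] Su; congr pair; first by apply: Ux => k; case: (Su k).
  by apply/funext => k; case: (Su k).
Qed.

(* The cardinal kappa is the cardinality of the type K. *)
Theorem theorem5p4 (X : topologicalType) (K : Type)
    (compactX : compact_hausdorff X)
    (character_le : forall x : X, character x #<= [set: K]) :
  pin_homogeneous (X * {ptws K -> bool})%type.
Proof.
have chZ : compact_hausdorff (X * {ptws K -> bool})%type.
  apply: compact_hausdorff_setX => //.
  apply: compact_hausdorff_prod_topology => _.
  by split; [exact: bool_compact|exact: discrete_hausdorff].
split=> // a b.
have [S [clS covS allS Sa Sa1]] :=
  closed_code compactX.2 (character_le a.1).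
have [S' [clS' covS' allS' Sb Sb1]] :=
  closed_code compactX.2 (character_le b.1).
apply: (@closed_relation_pin_equivalent _ _ _
  (fun z w => forall k, exists c, S k c z /\ S' k c w)) => //.
(* For each [k] the relation is a union of two closed rectangles, one per side. *)
- rewrite (_ : mkset _ = \bigcap_k
    ((fst @^-1` S k true `&` snd @^-1` S' k true) `|`
     (fst @^-1` S k false `&` snd @^-1` S' k false))); last first.
    apply/seteqP; split=> [z Rz k _|z Rz k].
      by have [[] ?] := Rz k; [left|right].
    by have [] := Rz k I; [exists true|exists false].
  apply: closed_bigI => k _; apply: closedU; apply: closedI;
    by apply: preimage_closed => // z _; by [exact: cvg_fst|exact: cvg_snd].
- move=> z; have /choice[c Sc] := covS z; have [w S'w] := allS' c.
  by exists w => k; exists (c k).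
- move=> w; have /choice[c S'c] := covS' w; have [z Sz] := allS c.
  by exists z => k; exists (c k).
(* As [a] avoids every [S k false], its partner [w] lies in every [S' k true], which forces [w = b];
   the converse is symmetric. *)
- move=> z w zw; split=> [za|wb].
    apply: Sb1 => k; have [[] [Sz S'w]] := zw k => //.
    by rewrite za in Sz; case: (Sa k).
  apply: Sa1 => k; have [[] [Sz S'w]] := zw k => //.
  by rewrite wb in S'w; case: (Sb k).
Qed.
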